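(* Let $U\subset\mathbb R^n$ be connected and open and $k\in\mathbb N$. Suppose that $\{f_j\}_{j\in\mathbb N}$ and $\{g_j\}_{j\in\mathbb N}$ are two sequences in $C^k(U)$ with the following properties. For each multi-index $\alpha$ with $|\alpha|\le k$, the sequences $\{\partial^\alpha f_i:i\in\mathbb N\}$ and $\{\partial^\alpha g_i:i\in\mathbb N\}$ are equicontinuous on $U$, and there are a compact $B\subset U$, $c\in\mathbb R_+$ and points $x_{j,\alpha}\in B$ such that $\sup\{|\partial^\alpha f_j(x_{j,\alpha})-\partial^\alpha g_j(x_{j,\alpha})|:j\in\mathbb N,\ |\alpha|\le k\}<c$. If for each $r>0$ and $x\in U$ there is $i_{x,r}\in\mathbb N$ such that $|f_i(x)-g_i(x)|<r$ for all $i\ge i_{x,r}$, then for each $s>0$ and $x\in U$ there is $j_{x,s}\in\mathbb N$ such that $|\partial^\alpha f_j(x)-\partial^\alpha g_j(x)|<s$ for every multi-index $\alpha$ with $|\alpha|\le k$ and all $j\ge j_{x,s}$.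
   Context: $C^k(U)$ is the space of real-valued $C^k$ functions on $U$. A sequence $\{h_j\}$ of functions on $U$ is equicontinuous (pointwise) if for each $x\in U$ and $r>0$ there is $s>0$ such that for $y\in U$ with $|y-x|<s$ one has $|h_j(y)-h_j(x)|<r$ for all $j$. *)

(* Defs.v *)
From mathcomp Require Export all_boot all_order all_algebra.
From mathcomp Require Export all_classical all_reals ereal topology normedtype derive.
Export Order.TTheory GRing.Theory Num.Theory.
Export numFieldNormedType.Exports.

Set Implicit Arguments.
Unset Strict Implicit.
Unset Printing Implicit Defensive.

Local Open Scope classical_set_scope.
Local Open Scope ring_scope.

(* A real function on an open set U of R^n is represented by a total function
   on 'rV[R]_n; all notions below only depend on its values on U. *)

(* The norm that the library puts on 'rV[R]_n is the sup norm; it induces the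
   same topology as this one. *)
Definition enorm (R : realType) (n : nat) (v : 'rV[R]_n) : R :=
  Num.sqrt (\sum_(i < n) v ord0 i ^+ 2).

Definition partial (R : realType) (n : nat) (i : 'I_n) (f : 'rV[R]_n -> R) :
    'rV[R]_n -> R :=
  fun x => 'D_(delta_mx ord0 i) f x.

Definition multi_index (n : nat) := {ffun 'I_n -> nat}.

Definition mi_size (n : nat) (alpha : multi_index n) : nat :=
  (\sum_(i < n) alpha i)%N.

(* With d_i the i-th partial derivative, this is
   d_0^(alpha 0) (d_1^(alpha 1) (... f)); the order is immaterial on C^k
   functions when |alpha| <= k. *)
Definition partialm (R : realType) (n : nat) (alpha : multi_index n)
    (f : 'rV[R]_n -> R) : 'rV[R]_n -> R :=
  foldr (fun i g => iter (alpha i) (partial i) g) f (enum 'I_n).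

(* All iterated partial derivatives of order at most k, taken in any order,
   exist and are continuous on U. *)
Fixpoint is_Ck (R : realType) (n : nat) (k : nat) (U : set 'rV[R]_n)
    (f : 'rV[R]_n -> R) : Prop :=
  {within U, continuous f} /\
  match k with
  | 0%N => True
  | k'.+1 => forall i : 'I_n,
      (forall x, U x -> derivable f x (delta_mx ord0 i)) /\
      is_Ck k' U (partial i f)
  end.

Definition equicontinuous_on (R : realType) (n : nat) (U : set 'rV[R]_n)
    (h : nat -> 'rV[R]_n -> R) : Prop :=
  forall (x : 'rV[R]_n) (r : R), U x -> 0 < r ->
    exists2 s : R, 0 < s &
      forall y : 'rV[R]_n, U y -> enorm (y - x) < s ->
        forall j : nat, `|h j y - h j x| < r.

(* Main.v *)
(* If u_j -> 0 pointwise on U and the partial derivatives d_i u_j are equicontinuous at x, then d_i u_j (x) -> 0: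
   for one fixed small t, the mean value theorem makes the difference quotient
   (u_j(x + t e_i) - u_j(x)) / t, which tends to 0, a value of d_i u_j at a point
   so close to x that it differs little from d_i u_j (x), uniformly in j.
   The theorem follows by induction on |alpha|, removing the outermost derivative. *)
Require Import Defs.
From mathcomp Require Import realfun lra.

Set Implicit Arguments.
Unset Strict Implicit.
Unset Printing Implicit Defensive.

Local Open Scope classical_set_scope.
Local Open Scope ring_scope.

Lemma enormZ_delta (R : realType) (n : nat) (t : R) (i : 'I_n) :
  enorm (t *: delta_mx ord0 i) = `|t|.
Proof.
rewrite /enorm (bigD1 i) //= big1 ?addr0 => [|l li].
  by rewrite !mxE !eqxx mulr1 sqrtr_sqr.
by rewrite !mxE (negbTE li) andbF mulr0 expr0n.
Qed.

(** The difference quotient of the restriction to the line, at [t], is literally the directional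
    quotient of [F] at [x + t *: e]. *)
Lemma is_derive_line (R : realType) (n : nat) (F : 'rV[R]_n -> R)
    (x e : 'rV[R]_n) (t : R) :
  derivable F (x + t *: e) e ->
  is_derive t (1 : R) (fun u : R => F (x + u *: e)) ('D_e F (x + t *: e)).
Proof.
have E : (fun h : R => h^-1 *: (F (x + (h *: (1 : R) + t) *: e) - F (x + t *: e)))
   = (fun h : R => h^-1 *: (F (h *: e + (x + t *: e)) - F (x + t *: e))).
  apply/funext => h; congr (_ *: (F _ - _)).
  by rewrite scalerDl [h *: (1 : R)]mulr1 addrCA.
move=> dF; apply: DeriveDef.
  by rewrite /derivable /= E.
by rewrite /derive /= E.
Qed.

Lemma open_line (R : realType) (n : nat) (U : set 'rV[R]_n) (x e : 'rV[R]_n) :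
  open U -> U x ->
  exists2 d : R, 0 < d & forall t, 0 <= t < d -> U (x + t *: e).
Proof.
move=> oU Ux.
have c : (fun t : R => x + t *: e) @ (0 : R) --> x + (0 : R) *: e.
  apply: cvgD; first exact: cvg_cst.
  by apply: cvgZr_tmp; exact: cvg_id.
have : \forall t \near (0 : R), U (x + t *: e).
  apply: (c U); rewrite scale0r addr0.
  exact: open_nbhs_nbhs.
move=> /nbhs_ballP[d /= d0 dU]; exists d => // t /andP[t0 td].
by apply: dU; rewrite /ball /= sub0r normrN ger0_norm.
Qed.

Lemma partial_diff_small (R : realType) (n : nat) (U : set 'rV[R]_n) (i : 'I_n)
    (F G : nat -> 'rV[R]_n -> R) (U_open : open U)
    (F_der : forall j x, U x -> derivable (F j) x (delta_mx ord0 i))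
    (G_der : forall j x, U x -> derivable (G j) x (delta_mx ord0 i))
    (F_equi : equicontinuous_on U (fun j => partial i (F j)))
    (G_equi : equicontinuous_on U (fun j => partial i (G j)))
    (FG_small : forall r x, 0 < r -> U x ->
      \forall j \near \oo, `|F j x - G j x| < r)
    (r : R) (x : 'rV[R]_n) (r_gt0 : 0 < r) (Ux : U x) :
  \forall j \near \oo, `|partial i (F j) x - partial i (G j) x| < r.
Proof.
(* Error budget: [r / 4] for moving each of the two derivatives from the intermediate point back to
   [x], and [r / 2] for the mean value quotient. *)
have r4 : 0 < r / 4 by rewrite divr_gt0.
have [d1 d1_gt0 F_close] := F_equi x _ Ux r4.
have [d2 d2_gt0 G_close] := G_equi x _ Ux r4.
set e : 'rV[R]_n := delta_mx ord0 i in F_der G_der *.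
have [d3 d3_gt0 lineU] := open_line e U_open Ux.
(* The step [t] is fixed before [j], so pointwise smallness is used only at the two points [x] and
   [x + t *: e]; the tolerance there is scaled by [t] because the increment of [phi] is later
   divided by [t]. *)
pose t := Num.min d1 (Num.min d2 d3) / 2.
have m0 : 0 < Num.min d1 (Num.min d2 d3) by rewrite !lt_min d1_gt0 d2_gt0.
have t0 : 0 < t by rewrite divr_gt0.
have : t < Num.min d1 (Num.min d2 d3) by rewrite /t; lra.
rewrite !lt_min => /and3P[td1 td2 td3].
have rt : 0 < r / 4 * t by rewrite mulr_gt0.
have Uxt : U (x + t *: e) by apply: lineU; rewrite ltW.
near=> j.
have Fx : `|F j x - G j x| < r / 4 * t by near: j; exact: FG_small.
have Fxt : `|F j (x + t *: e) - G j (x + t *: e)| < r / 4 * t.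
  by near: j; exact: FG_small.
pose phi (u : R) := F j (x + u *: e) - G j (x + u *: e).
pose dphi (u : R) := partial i (F j) (x + u *: e) - partial i (G j) (x + u *: e).
have dphiP u : 0 <= u < d3 -> is_derive u (1 : R) phi (dphi u).
  move=> ud; apply: is_deriveB; apply: is_derive_line.
    exact/F_der/lineU.
  exact/G_der/lineU.
(* The intermediate [u] depends on [j]; this is harmless since the radii [d1] and [d2] do not. *)
have [||u /[!in_itv]/= /andP[u0 ut]] := @MVT R phi dphi 0 t t0.
- move=> u /[!in_itv]/= /andP[u0 ut]; apply: dphiP.
  by rewrite ltW // (lt_trans ut).
- apply: derivable_within_continuous => u /[!in_itv]/= /andP[u0 ut].
  by have [] := dphiP u; rewrite ?u0 ?(le_lt_trans ut).
rewrite subr0 /phi scale0r addr0 => phiE.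
have xu : enorm (x + u *: e - x) < Num.min d1 d2.
  rewrite addrAC subrr add0r enormZ_delta gtr0_norm // lt_min.
  by rewrite (lt_trans ut td1) (lt_trans ut td2).
have Uxu : U (x + u *: e) by apply: lineU; rewrite ltW // (lt_trans ut).
move: xu; rewrite lt_min => /andP[xu1 xu2].
have /ltr_normlP[F1 F2] := F_close _ Uxu xu1 j.
have /ltr_normlP[G1 G2] := G_close _ Uxu xu2 j.
have : `|dphi u| < r / 2.
  rewrite -(ltr_pM2r t0) -[X in _ * X < _](gtr0_norm t0) -normrM -phiE.
  by rewrite (le_lt_trans (ler_normB _ _))//; lra.
move=> /ltr_normlP[]; rewrite /dphi => D1 D2.
by apply/ltr_normlP; split; lra.
Unshelve. all: by end_near. Qed.

Definition mi_pred (n : nat) (i : 'I_n) (alpha : multi_index n) : multi_index n :=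
  [ffun l => if l == i then (alpha l).-1 else alpha l].

Lemma mi_size_pred (n : nat) (i : 'I_n) (alpha : multi_index n) :
  (0 < alpha i)%N -> mi_size alpha = (mi_size (mi_pred i alpha)).+1.
Proof.
move=> ai; rewrite /mi_size (bigD1 i) //= [in RHS](bigD1 i) //= ffunE eqxx -addSn prednK //.
by congr addn; apply: eq_bigr => l li; rewrite ffunE (negbTE li).
Qed.

(** The outermost derivative belongs to the first index of [s] with a positive entry, since earlier
    indices contribute empty iterations. Hence no partial derivatives are interchanged, and [i] is
    the same for every [f]. *)
Lemma foldr_partial_outer (R : realType) (n : nat) (alpha : multi_index n)
    (s : seq 'I_n) :
  uniq s -> has (fun i => 0 < alpha i)%N s ->
  exists i, [/\ i \in s, (0 < alpha i)%N & forall f : 'rV[R]_n -> R,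
    foldr (fun l g => iter (alpha l) (partial l) g) f s =
    partial i (foldr (fun l g => iter (mi_pred i alpha l) (partial l) g) f s)].
Proof.
elim: s => //= a s IHs /andP[as_ us].
have [a0|a0] := posnP (alpha a); last first.
  move=> _; exists a; split; rewrite ?mem_head// => f.
  rewrite ffunE eqxx -[in LHS](prednK a0) iterS; congr (partial _ (iter _ _ _)).
  (* As [a] does not occur in the tail, lowering its entry leaves the inner fold unchanged. *)
  elim: s as_ {IHs us} => //= b s IHs; rewrite inE negb_or => /andP[ab as_].
  by rewrite IHs// ffunE eq_sym (negbTE ab).
rewrite a0 /= => hs.
have [i [is_ ai fE]] := IHs us hs.
exists i; split; rewrite ?inE ?is_ ?orbT// => f.
(* The entry at [a] stays 0 in either case, as the predecessor of 0 is 0. *)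
by rewrite fE ffunE a0 if_same.
Qed.

Lemma partialm_outer (R : realType) (n : nat) (alpha : multi_index n) :
  (0 < mi_size alpha)%N ->
  exists (i : 'I_n) (beta : multi_index n), mi_size alpha = (mi_size beta).+1 /\
    forall f : 'rV[R]_n -> R, partialm alpha f = partial i (partialm beta f).
Proof.
move=> a0.
have hs : has (fun i => 0 < alpha i)%N (enum 'I_n).
  apply: contraLR a0 => /hasPn H; rewrite -leqNgt leqn0 /mi_size.
  by rewrite sum_nat_eq0; apply/forallP => i; rewrite -leqn0 leqNgt H ?mem_enum.
have [i [_ ai fE]] := foldr_partial_outer R (enum_uniq 'I_n) hs.
by exists i, (mi_pred i alpha); split; [exact: mi_size_pred|].
Qed.

Lemma partialm_size0 (R : realType) (n : nat) (alpha : multi_index n)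
    (f : 'rV[R]_n -> R) : mi_size alpha = 0%N -> partialm alpha f = f.
Proof.
move=> /eqP; rewrite /mi_size sum_nat_eq0 => /forallP a0; rewrite /partialm.
by elim: (enum _) => //= a s ->; rewrite (eqP (a0 a)).
Qed.

(** Induction on the size: each outermost derivative removed costs one order of smoothness. *)
Lemma is_Ck_partialm (R : realType) (n k : nat) (U : set 'rV[R]_n)
    (alpha : multi_index n) (f : 'rV[R]_n -> R) :
  (mi_size alpha <= k)%N -> is_Ck k U f ->
  is_Ck (k - mi_size alpha) U (partialm alpha f).
Proof.
move: {2}(mi_size alpha) (erefl (mi_size alpha)) => m.
elim: m alpha => [|m IHm] alpha am ak fk.
  by rewrite partialm_size0 // am subn0.
have [|i [beta [ab ->]]] := @partialm_outer R n alpha; first by rewrite am.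
have bm : mi_size beta = m by apply: succn_inj; rewrite -ab.
have bk : (mi_size beta < k)%N by rewrite -ab.
have := IHm beta bm (ltnW bk) fk.
(* Writing [k - mi_size beta] as a successor lets the fixpoint [is_Ck] unfold once. *)
by rewrite ab -(subnSK bk) /= => -[_ /(_ i)[]].
Qed.

Lemma partialm_diff_small (R : realType) (n k : nat) (U : set 'rV[R]_n)
    (f g : nat -> 'rV[R]_n -> R) (U_open : open U)
    (f_Ck : forall j, is_Ck k U (f j)) (g_Ck : forall j, is_Ck k U (g j))
    (f_equi : forall alpha : multi_index n, (mi_size alpha <= k)%N ->
      equicontinuous_on U (fun j => partialm alpha (f j)))
    (g_equi : forall alpha : multi_index n, (mi_size alpha <= k)%N ->
      equicontinuous_on U (fun j => partialm alpha (g j)))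
    (fg_small : forall r x, 0 < r -> U x ->
      \forall j \near \oo, `|f j x - g j x| < r)
    (alpha : multi_index n) (r : R) (x : 'rV[R]_n) :
  (mi_size alpha <= k)%N -> 0 < r -> U x ->
  \forall j \near \oo, `|partialm alpha (f j) x - partialm alpha (g j) x| < r.
Proof.
(* The induction on the size keeps [r] and [x] general: the inductive step needs smallness of the
   lower derivative at nearby points and for smaller tolerances. *)
move: {2}(mi_size alpha) (erefl (mi_size alpha)) => m.
elim: m alpha r x => [|m IHm] alpha r x am ak r0 Ux.
  near=> j; rewrite !partialm_size0//; near: j.
  exact: fg_small.
have [|i [beta [ab aE]]] := @partialm_outer R n alpha; first by rewrite am.
have bm : mi_size beta = m by apply: succn_inj; rewrite -ab.
have bk : (mi_size beta < k)%N by rewrite -ab.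
have der h y : is_Ck k U h -> U y ->
    derivable (partialm beta h) y (delta_mx ord0 i).
  move=> /(is_Ck_partialm (ltnW bk)); rewrite -(subnSK bk) /=.
  by move=> -[_ /(_ i)[+ _]]; apply.
(* Equicontinuity assumed at order [alpha] is exactly that of the [i]-th partial derivative of the
   functions of order [beta]. *)
have equi h : equicontinuous_on U (fun j => partialm alpha (h j)) ->
    equicontinuous_on U (fun j => partial i (partialm beta (h j))).
  by under eq_fun do rewrite aE.
near=> j; rewrite !aE; near: j.
apply: (partial_diff_small U_open) => //.
- by move=> j y; exact: der.
- by move=> j y; exact: der.
- exact/equi/f_equi.
- exact/equi/g_equi.
- by move=> r' y r'0 Uy; apply: IHm => //; exact: ltnW.
Unshelve. all: by end_near. Qed.

Theorem corollary9p2 (R : realType) (n : nat) (U : set 'rV[R]_n)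
    (U_connected : connected U) (U_open : open U) (k : nat)
    (f g : nat -> 'rV[R]_n -> R)
    (f_Ck : forall j, is_Ck k U (f j)) (g_Ck : forall j, is_Ck k U (g j))
    (f_equi : forall alpha : multi_index n, (mi_size alpha <= k)%N ->
      equicontinuous_on U (fun j => partialm alpha (f j)))
    (g_equi : forall alpha : multi_index n, (mi_size alpha <= k)%N ->
      equicontinuous_on U (fun j => partialm alpha (g j)))
    (B : set 'rV[R]_n) (B_compact : compact B) (B_sub : B `<=` U)
    (c : R) (c_ge0 : 0 <= c)
    (p : nat -> multi_index n -> 'rV[R]_n)
    (p_B : forall (j : nat) (alpha : multi_index n),
      (mi_size alpha <= k)%N -> B (p j alpha))
    (p_bound : (ereal_sup [set z : \bar R |
        exists (j : nat) (alpha : multi_index n), (mi_size alpha <= k)%N /\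
          z = (`|partialm alpha (f j) (p j alpha)
                 - partialm alpha (g j) (p j alpha)|)%:E] < c%:E)%E)
    (fg_close : forall (r : R) (x : 'rV[R]_n), 0 < r -> U x ->
      exists i0 : nat, forall i : nat, (i0 <= i)%N -> `|f i x - g i x| < r) :
  forall (s : R) (x : 'rV[R]_n), 0 < s -> U x ->
    exists j0 : nat, forall (alpha : multi_index n) (j : nat),
      (mi_size alpha <= k)%N -> (j0 <= j)%N ->
      `|partialm alpha (f j) x - partialm alpha (g j) x| < s.
Proof.
move=> s x s0 Ux.
(* One threshold must serve all [alpha]. Multi-indices of size at most [k] have entries at most [k],
   so they are coded by a finite type, over which eventual statements can be intersected; codes of
   size above [k] satisfy the claim vacuously. *)
have small : \forall j \near \oo, forall b : {ffun 'I_n -> 'I_k.+1},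
    let alpha : multi_index n := [ffun i => b i : nat] in
    (mi_size alpha <= k)%N ->
    `|partialm alpha (f j) x - partialm alpha (g j) x| < s.
  apply: filter_forall => b /=.
  have [bk|bk] := leqP (mi_size [ffun i => b i : nat]) k; last exact: nearW.
  have fg_small r y : 0 < r -> U y -> \forall j \near \oo, `|f j y - g j y| < r.
    by move=> r0 Uy; have [i0 i0P] := fg_close r y r0 Uy; exists i0.
  have := partialm_diff_small U_open f_Ck g_Ck f_equi g_equi fg_small bk s0 Ux.
  by apply: filterS.
case: small => j0 _ j0P; exists j0 => alpha j ak j0j.
(* The code of [alpha] is faithful: [inord] loses nothing because each entry is at most
   [mi_size alpha], hence at most [k]. *)
have aE : alpha = [ffun i => [ffun i => inord (alpha i) : 'I_k.+1] i : nat].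
  apply/ffunP => i; rewrite !ffunE inordK// ltnS (leq_trans _ ak)//.
  by rewrite /mi_size (bigD1 i)//= leq_addr.
by rewrite aE; apply: j0P; rewrite -?aE.
Qed.
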